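(* Let $H$ be a separable, infinite dimensional real Hilbert space and let $C\subseteq H$ be a closed, convex set. If $C$ is totally unbounded, then there is a residual set $\mathcal{R}\subseteq\mathcal{N}(C)$ such that every $f\in\mathcal{R}$ fails to have any fixed points.
   Context: For a subset $C$ of a Hilbert space $H$ with norm $\|\cdot\|$, $\mathcal{N}(C)$ denotes the set of all nonexpansive mappings $f\colon C\to C$, i.e. mappings with $\|f(x)-f(y)\|\le\|x-y\|$ for all $x,y\in C$. It is endowed with the topology of pointwise convergence, i.e. the coarsest topology containing all sets $\{g\in\mathcal{N}(C): \|g(x)-f(x)\|<\varepsilon\}$ with $f\in\mathcal{N}(C)$, $x\in C$, $\varepsilon>0$. A nonempty, non-singleton convex set $C$ in an infinite dimensional Hilbert space $H$ is called somewhat bounded if there are $x_0\in C$, a finite dimensional subspace $F\subseteq H$ and $\alpha>0$ such that $\alpha B_F\subseteq C-x_0$ and $F^\perp\cap(C-x_0)$ is bounded. Here $B_F$ is the closed unit ball of $F$ and $F^\perp$ the orthogonal complement of $F$ in $H$. A nonempty, non-singleton convex set $C\subseteq H$ is called totally unbounded if it is not somewhat bounded. A subset of a topological space is meager if it is a countable union of nowhere dense sets, and residual if its complement is meager. *)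

(* Defs.v *)
From HB Require Import structures.
From mathcomp Require Import all_boot all_order all_algebra.
From mathcomp Require Import sesquilinear.
From mathcomp Require Import all_classical all_reals all_analysis.

Set Implicit Arguments.
Unset Strict Implicit.
Unset Printing Implicit Defensive.

Import Order.TTheory GRing.Theory Num.Theory.
Import numFieldNormedType.Exports.

Local Open Scope classical_set_scope.
Local Open Scope ring_scope.

Definition separable (T : topologicalType) :=
  exists2 D : set T, countable D & dense D.

Definition nowhere_dense (T : topologicalType) (A : set T) :=
  interior (closure A) = set0.

Definition meager (T : topologicalType) (A : set T) :=
  exists2 F : nat -> set T,
    (forall n, nowhere_dense (F n)) & A = \bigcup_n F n.

Definition residual (T : topologicalType) (A : set T) := meager (~` A).

Definition lspan (R : nzRingType) (V : lmodType R) (s : seq V) : set V :=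
  [set \sum_(i < size s) a i *: s`_i | a in [set: 'I_(size s) -> R]].

Definition finite_dim_subspace (R : nzRingType) (V : lmodType R) (F : set V) :=
  exists s : seq V, F = lspan s.

Definition infinite_dim (R : nzRingType) (V : lmodType R) :=
  ~ finite_dim_subspace [set: V].

(* A real Hilbert space is rendered as a [completeNormedModType] over a
   [realType] whose norm is induced by a symmetric positive definite bilinear
   form [dot]. *)
Definition induces_norm (R : realType) (H : normedModType R)
    (dot : {dot H for @idfun R}) :=
  forall x : H, `|x| = Num.sqrt (dot x x).

Section Unboundedness.
Context {R : realType} {H : normedModType R} (dot : {dot H for @idfun R}).
Implicit Types C F : set H.

Definition orthogonal_complement F : set H :=
  [set x | forall y, F y -> dot x y = 0].

Definition unit_ball F : set H := [set y | F y /\ `|y| <= 1].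

Definition translate C (x0 : H) : set H := [set x - x0 | x in C].

Definition nontrivial_convex C :=
  [/\ C !=set0, (forall x, C <> [set x]) & convex_set C].

(* [F] may be the zero subspace, so bounded sets are somewhat bounded. *)
Definition somewhat_bounded C :=
  nontrivial_convex C /\
  exists (x0 : H) (F : set H) (alpha : R),
    [/\ C x0, finite_dim_subspace F, 0 < alpha,
        [set alpha *: y | y in unit_ball F] `<=` translate C x0 &
        bounded_set (orthogonal_complement F `&` translate C x0)].

Definition totally_unbounded C := nontrivial_convex C /\ ~ somewhat_bounded C.

End Unboundedness.

Section Nonexpansive.
Context {R : realType} {H : normedModType R} (C : set H).

(* Used as types, [C] and [nonexpansive C] are the subtypes of their points with
   the induced topologies (from [H] and from [{ptws C -> C}]). *)
Definition nonexpansive : set {ptws C -> C} :=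
  [set f | forall x y : C, `|\val (f x) - \val (f y)| <= `|\val x - \val y|].

End Nonexpansive.

Arguments nonexpansive {R H} C.

(* The two lemmas below show that the topology of [nonexpansive C] is the
   coarsest one containing the sets [nonexpansive_ball f x e], [e > 0]. *)
Section PointwiseTopology.
Context {R : realType} {H : normedModType R} (C : set H).
Local Notation N := (nonexpansive C).

Definition nonexpansive_ball (f : N) (x : C) (e : R) : set N :=
  [set g | `|\val (\val g x) - \val (\val f x)| < e].

Lemma nonexpansive_ball_open f x e : open (nonexpansive_ball f x e).
Proof.
pose ev (g : N) : H := set_val ((set_val g : {ptws C -> C}) x).
have evc : continuous ev.
  move=> g; rewrite /ev.
  apply: (@continuous_comp N C H (fun g => (set_val g : {ptws C -> C}) x) set_val);
    last exact: initial_continuous.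
  apply: (@continuous_comp N {ptws C -> C} C set_val (fun h => h x)).
    exact: initial_continuous.
  exact: (@proj_continuous C (fun _ => C) x).
have -> : nonexpansive_ball f x e = ev @^-1` ball (ev f) e.
  apply/seteqP; split=> g; rewrite /nonexpansive_ball/= -ball_normE/= distrC;
    by rewrite /ev !set_valE.
by apply: open_comp (ball_open _ _) => g _; exact: evc.
Qed.

Lemma open_nonexpansive_coarsest (op : set (set N)) :
    (forall f x e, 0 < e -> op (nonexpansive_ball f x e)) ->
    op [set: N] -> setI_closed op ->
    (forall D : set (set N), D `<=` op -> op (\bigcup_(A in D) A)) ->
  @open N `<=` op.
Proof.
move=> opb opT opI opU _ [V oV <-].
have opev (x : C) (O : set C) : open O -> op [set g : N | O (\val g x)].
  move=> [W oW WO].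
  set E := [set g : N | _].
  have -> : E = \bigcup_(A in [set A | op A /\ A `<=` E]) A.
    apply/seteqP; split=> [g Eg|g [A [_ AE] /AE]//].
    have : nbhs (\val (\val g x)) W.
      apply: open_nbhs_nbhs; split => //.
      by move: Eg; rewrite /E/= -WO/= set_valE.
    move=> /nbhs_ballP[e /= e0 eW].
    exists (nonexpansive_ball g x e); last by rewrite /nonexpansive_ball/= subrr normr0.
    split; first exact: opb.
    move=> h hg; rewrite /E/= -WO/= set_valE; apply: eW.
    by rewrite -ball_normE/= distrC.
  by apply: opU => A [].
case: oV => D' D'f <-.
have -> : set_val @^-1` (\bigcup_(i in D') i) =
    \bigcup_(A in [set set_val @^-1` i | i in D']) A :> set N.
  apply/seteqP; split=> [g [i D'i ig]|g [_ [i D'i <-] ig]].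
    by exists (set_val @^-1` i) => //; exists i.
  by exists i.
apply: opU => _ [_ /D'f[G Gs <-] <-].
rewrite bigcap_fset big_seq; elim/big_ind: _ => [|A B|A].
- by rewrite preimage_setT.
- by rewrite preimage_setI; exact: opI.
- move=> /Gs; rewrite inE => -[x _ [U oU <-]].
  have -> : set_val @^-1` ((fun f : forall i : C, C => f x) @^-1` U) =
      [set g : N | U (\val g x)].
    by apply/seteqP; split => g; rewrite /= set_valE.
  exact: opev.
Qed.

End PointwiseTopology.

(* Main.v *)
Require Import Defs.
From HB Require Import structures.
From mathcomp Require Import all_boot all_order all_algebra.
From mathcomp Require Import sesquilinear.
From mathcomp Require Import ring lra.
From mathcomp Require Import all_classical all_reals all_analysis.
Import Order.TTheory GRing.Theory Num.Theory.
Import numFieldNormedType.Exports.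
Local Open Scope classical_set_scope.
Local Open Scope ring_scope.

(** If [h] is nonexpansive and [h x = x], then [`|h y - x| <= `|y - x|] for
    every [y]: one point [y] whose image lies farther than [y] from every point
    of a ball thus rules out fixed points in that ball, and this survives small
    changes of the single value [h y].  So it is enough to show that any
    nonexpansive [f], any finite set of its values and any radius [r] admit a
    nonexpansive [g] which nearly keeps these values and moves some [y] away
    from the ball of radius [r]; the maps with a fixed point of norm at most [n]
    are then nowhere dense for each [n].

    The finitely many points involved and their images lie in [x0 + F], where
    [F] is a finite dimensional subspace and [x0] is relatively interior to
    their convex hull, that is, a small ball of [F] around [x0] stays inside [C]
    ([finite_hull_interior]).  This is the configuration to which total
    unboundedness applies: it yields a unit vector [v] orthogonal to [F] and a
    point [x0 + L *: v] of [C] with [L] as large as needed.  The map [g] acts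
    like [f] in the directions orthogonal to [v], translates by a small [theta]
    along [v], and is brought back into [C] by the nearest point retraction
    ([nonexpansive_retraction]).  On [x0 + F] this costs at most [theta].  On the
    other hand [y = x0 + a *: v] is pushed further by [theta] in the direction
    [v].  For large [a] the distance from [y] to a point [x] near [x0] barely
    exceeds its part measured along [v], while the distance from the image of [y]
    to [x] is at least the part along [v], which has grown by [theta].  The
    retraction does not spoil this, because the image of [y] is close to [C]: as
    [L] grows, the segment of [C] from [f x0] to [x0 + L *: v] comes near it
    ([escaping_perturbation]). *)

(** * Inner products *)

Section InnerProduct.
Context {R : realType} {H : normedModType R} (dot : {dot H for @idfun R}).
Hypothesis dot_norm : induces_norm dot.
Implicit Types (u v x y : H) (a : R).

Lemma dotDl u v x : dot (u + v) x = dot u x + dot v x.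
Proof. exact: linearDl. Qed.

Lemma dotDr u v x : dot x (u + v) = dot x u + dot x v.
Proof. exact: linearDr. Qed.

Lemma dotNl u x : dot (- u) x = - dot u x.
Proof. exact: linearNl. Qed.

Lemma dotNr u x : dot x (- u) = - dot x u.
Proof. exact: linearNr. Qed.

Lemma dotZl a u x : dot (a *: u) x = a * dot u x.
Proof. exact: (linearZl_LR dot). Qed.

Lemma dotZr a u x : dot x (a *: u) = a * dot x u.
Proof. exact: (linearZr_LR dot). Qed.

Definition dotE := (dotDl, dotDr, dotNl, dotNr, dotZl, dotZr).

Lemma dotC x y : dot x y = dot y x.
Proof. by rewrite hermC expr0 mul1r. Qed.

Lemma sqr_norm x : `|x| ^+ 2 = dot x x.
Proof.
rewrite dot_norm sqr_sqrtr//; have [->|x0] := eqVneq x 0.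
  by rewrite linear0l.
exact/ltW/neq0_dnorm_gt0.
Qed.

Lemma ler_norm_sqr x y : (`|x| <= `|y|) = (dot x x <= dot y y).
Proof. by rewrite -!sqr_norm ler_pXn2r// nnegrE. Qed.

(** Testing against every [z] turns an identity between vectors into an identity
    between reals, which the ring tactics decide. *)
Lemma dot_ext x y : (forall z, dot x z = dot y z) -> x = y.
Proof.
move=> xy; apply/eqP; rewrite -subr_eq0 -normr_eq0 -sqrf_eq0.
by rewrite sqr_norm dotDl dotNl xy subrr.
Qed.

Lemma ler_norm_orth u w :
  dot u w = 0 -> `|u| <= `|u + w| /\ `|w| <= `|u + w|.
Proof.
move=> uw; rewrite !ler_norm_sqr !dotE (dotC w) uw.
by rewrite -!sqr_norm; split; rewrite ?add0r ?addr0 ?lerDl ?lerDr.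
Qed.

Lemma dot_unit_le v u : dot v v = 1 -> `|dot u v| <= `|u|.
Proof.
move=> v1; rewrite -(@ler_pXn2r _ 2)// ?nnegrE// real_normK ?num_real//.
rewrite sqr_norm.
have := sqr_ge0 `|u - dot u v *: v|; rewrite sqr_norm.
rewrite !dotE v1 (dotC v u); lra.
Qed.

Definition reject v u : H := u - dot u v *: v.

Lemma pythagoras_reject v u a : dot v v = 1 ->
  dot (reject v u + a *: v) (reject v u + a *: v) = dot u u - dot u v ^+ 2 + a ^+ 2.
Proof. by move=> v1; rewrite /reject !dotE v1 (dotC v u); ring. Qed.
End InnerProduct.

(** * The nearest point retraction onto a closed convex set *)

Lemma convex_comb {R : realType} {H : normedModType R} {C : set H} {x y : H}
    (t : R) :
  convex_set C -> C x -> C y -> 0 <= t <= 1 -> C (t *: x + (1 - t) *: y).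
Proof.
move=> convC Cx Cy /andP[t0 t1]; apply/set_mem.
exact: (convC x y (Itv01 t0 t1) (mem_set Cx) (mem_set Cy)).
Qed.

Section Projection.
Context {R : realType} {H : completeNormedModType R}.
Context (dot : {dot H for @idfun R}).
Hypothesis dot_norm : induces_norm dot.
Context (C : set H).
Hypotheses (C_convex : convex_set C) (C_closed : closed C) (C_nonempty : C !=set0).

(** A minimizing sequence is Cauchy by the parallelogram identity, since the
    midpoint of two almost nearest points is itself no nearer than the infimum;
    the sequence is replaced here by the filter of almost nearest points. *)
Lemma nearest_point (x : H) :
  exists2 p, C p & forall c, C c -> `|x - p| <= `|x - c|.
Proof.
pose D := [set `|x - c| | c in C]; pose d := inf D.
have Dlb : has_lbound D by exists 0 => _ [c _ <-].
have Dinf : has_inf D.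
  by split => //; case: C_nonempty => c Cc; exists `|x - c|, c.
have d0 : 0 <= d by apply: lb_le_inf; [case: Dinf|move=> _ [c _ <-]].
have dC c : C c -> d <= `|x - c| by move=> Cc; apply: ge_inf => //; exists c.
pose almost e : set H := [set c | C c /\ `|x - c| < d + e].
pose F := filter_from [set e : R | 0 < e] almost.
have FF : ProperFilter F.
  apply: filter_from_proper; last first.
    move=> e e0; have [_ [c Cc <-] ce] := inf_adherent e0 Dinf.
    by exists c; split.
  apply: filter_from_filter; first by exists 1 => /=.
  move=> e1 e2 /= e10 e20; exists (Num.min e1 e2); first by rewrite lt_min e10.
  move=> c [Cc]; rewrite -ltrBlDl lt_min !ltrBlDl => /andP[c1 c2].
  by split; split.
have parallelogram c c' e : almost e c -> almost e c' ->
    `|c - c'| ^+ 2 <= 4 * e * (2 * d + e).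
  move=> [Cc ce] [Cc' ce'].
  set mid := 2^-1 *: c + (1 - 2^-1) *: c'.
  have dm : d <= `|x - mid| := dC _ (convex_comb 2^-1 C_convex Cc Cc' ltac:(lra)).
  have ge0 z := normr_ge0 (x - z).
  have sq z := sqr_norm _ dot_norm z.
  have : `|x - c| ^+ 2 + `|x - c'| ^+ 2 = 2^-1 * `|c - c'| ^+ 2 +
      2 * `|x - mid| ^+ 2.
    rewrite /mid !sq !(dotE dot) (dotC dot c' c) (dotC dot c x) (dotC dot c' x); lra.
  have sq_le (a b : R) : 0 <= a -> a <= b -> a ^+ 2 <= b ^+ 2 by nra.
  have := sq_le _ _ d0 dm.
  have := sq_le _ _ (ge0 c) (ltW ce); have := sq_le _ _ (ge0 c') (ltW ce').
  lra.
have /cauchy_cvgP/cvg_ex[l Fl] : cauchy F.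
  apply: cauchy_exP => e e0.
  (* As [del <= 1], the bound [4 * del * (2 * d + del)] of the parallelogram
     estimate is less than [del * k]. *)
  pose k := 8 * d + 5; pose del := Num.min 1 (e ^+ 2 / k).
  have k0 : 0 < k by rewrite /k; lra.
  have del0 : 0 < del by rewrite lt_min ltr01/= divr_gt0// exprn_gt0.
  have del1 : del <= 1 by rewrite ge_min lexx.
  have delk : del * k <= e ^+ 2 by rewrite -ler_pdivlMr// ge_min lexx orbT.
  have [c cdel] : almost del !=set0.
    by have [_ [c Cc <-] ce] := inf_adherent del0 Dinf; exists c; split.
  exists c; exists del => // c' c'del; rewrite -ball_normE/=.
  rewrite -(@ltr_pXn2r _ 2)// ?nnegrE ?(ltW e0)//.
  apply: le_lt_trans (parallelogram _ _ _ cdel c'del) _.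
  rewrite /k in delk; nra.
have lim e : 0 < e -> exists2 c, almost e c & `|l - c| < e.
  move=> e0.
  have : F (ball l e `&` almost e).
    by apply: filterI; [apply: Fl; exact: nbhsx_ballx|exists e].
  by move=> /filter_ex[c [+ ce]]; rewrite -ball_normE => lc; exists c.
exists l.
  apply: C_closed => B /nbhs_ballP[e /= e0 eB].
  have [c [Cc _] lc] := lim _ e0.
  by exists c; split => //; apply: eB; rewrite -ball_normE.
move=> c Cc; apply: le_trans (dC _ Cc); apply/ler_addgt0Pr => e e0.
have [c' [_ c'e] lc'] := lim (e / 2) ltac:(lra).
have := ler_distD c' x l; rewrite (distrC c' l); lra.
Qed.

(** Moving from [p] towards [c] cannot decrease the distance to [x]. *)
Lemma nearest_point_obtuse x p :
  C p -> (forall c, C c -> `|x - p| <= `|x - c|) ->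
  forall c, C c -> dot (x - p) (c - p) <= 0.
Proof.
move=> Cp pmin c Cc; rewrite leNgt; apply/negP => a0.
set a := dot _ _ in a0; set q := dot (c - p) (c - p).
have along t : 0 <= t <= 1 -> 2 * t * a <= t ^+ 2 * q.
  move=> t01; have := pmin _ (convex_comb t C_convex Cc Cp t01).
  rewrite (ler_norm_sqr _ dot_norm).
  have -> : x - (t *: c + (1 - t) *: p) = (x - p) - t *: (c - p).
    by rewrite scalerBl scale1r scalerBr !opprD !opprK !addrA [in LHS](addrAC x).
  rewrite !(dotDl _ (x - p)) !(dotDr _ (x - p)) !(dotNl, dotNr) !(dotZl, dotZr).
  rewrite (dotC dot (c - p)) -/a -/q; lra.
have q0 : 0 < q by have := along 1 ltac:(lra); lra.
have aq : a / q <= 1 by rewrite ler_pdivrMr//; have := along 1 ltac:(lra); lra.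
have aq0 : 0 < a / q by rewrite divr_gt0.
(* The minimizer of [t ^+ 2 * q - 2 * t * a] refutes [along]. *)
have := along (a / q) ltac:(lra).
have -> : (a / q) ^+ 2 * q = a / q * a by rewrite expr2 -mulrA divfK// gt_eqF.
nra.
Qed.

(** The angles of the quadrilateral [x], [P x], [P y], [y] at [P x] and [P y] are
    obtuse, so its side from [x] to [y] is at least as long as the opposite one. *)
Lemma nonexpansive_retraction : exists P : H -> H,
  [/\ forall x, C (P x), forall x y, `|P x - P y| <= `|x - y| &
      forall x c, C c -> `|x - P x| <= `|x - c|].
Proof.
have /choice[P Pmin] x : exists p, C p /\ forall c, C c -> `|x - p| <= `|x - c|.
  by have [p] := nearest_point x; exists p.
have CP x : C (P x) by case: (Pmin x).
have minP x c : C c -> `|x - P x| <= `|x - c| by case: (Pmin x) => _; exact.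
exists P; split=> // x y.
have hx := nearest_point_obtuse _ _ (CP x) (minP x) _ (CP y).
have hy := nearest_point_obtuse _ _ (CP y) (minP y) _ (CP x).
have := sqr_ge0 `|(x - y) - (P x - P y)|; rewrite (sqr_norm _ dot_norm).
rewrite (ler_norm_sqr _ dot_norm).
move: hx hy; rewrite !(dotE dot) !(dotC dot _ x) !(dotC dot _ y) (dotC dot (P y) (P x)).
lra.
Qed.
End Projection.

(** * Relative interior of a finite convex hull *)

Section Span.
Context {R : realType} {V : lmodType R}.
Implicit Types (s : seq V) (u v w : V).

Lemma lspan_nil v : lspan [::] v <-> v = 0.
Proof.
split=> [[a _ <-]|->]; first by rewrite big_ord0.
by exists (fun=> 0) => //; rewrite big_ord0.
Qed.

Lemma lspan_cons w s v :
  lspan (w :: s) v <-> exists2 u, lspan s u & exists a, v = u + a *: w.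
Proof.
split=> [[a _ <-]|[_ [b _ <-] [a ->]]].
  rewrite big_ord_recl/= addrC; eexists; last by exists (a ord0).
  by exists (fun i => a (lift ord0 i)).
exists (fun i : 'I_(size s).+1 => oapp b a (unlift ord0 i)) => //.
rewrite big_ord_recl/= unlift_none addrC; congr (_ + _).
by apply: eq_bigr => i _; rewrite liftK.
Qed.

Lemma lspan_lin s a b u v : lspan s u -> lspan s v -> lspan s (a *: u + b *: v).
Proof.
move=> [f _ <-] [g _ <-]; exists (fun i => a * f i + b * g i) => //.
rewrite !scaler_sumr -big_split/=; apply: eq_bigr => i _.
by rewrite scalerDl !scalerA.
Qed.
End Span.

Section RelativeInterior.
Context {R : realType} {H : normedModType R} (dot : {dot H for @idfun R}).
Hypothesis dot_norm : induces_norm dot.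
Context (C : set H).
Hypothesis C_convex : convex_set C.

Definition has_orthogonal_projection (F : set H) :=
  forall x, exists2 u, F u & orthogonal_complement dot F (x - u).

(** Adding one point [c] at a time: if [c = x0 + u + w] with [u] in the current
    span and [w != 0] orthogonal to it, then the midpoint of [x0] and [c] is
    interior in the span enlarged by [w], since the hull of the current ball and
    [c] is a cone with nonempty interior there.  The orthogonal projection is
    part of the induction because it decomposes the next point. *)
Lemma finite_hull_interior (c0 : H) (cs : seq H) :
    C c0 -> {in cs, forall c, C c} ->
  exists (x0 : H) (s : seq H) (alpha : R), [/\ C x0 /\ 0 < alpha,
    has_orthogonal_projection (lspan s),
    forall y, lspan s y -> `|y| <= alpha -> C (x0 + y) &
    {in cs, forall c, lspan s (c - x0)}].
Proof.
move=> Cc0; elim: cs => [_|c cs ih Ccs].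
  exists c0, [::], 1; split => //.
    move=> x; exists 0; first exact/lspan_nil.
    by move=> y /lspan_nil->; rewrite linear0r.
  by move=> y /lspan_nil-> _; rewrite addr0.
have Cc : C c by apply: Ccs; rewrite mem_head.
have [|x0 [s [alpha [[Cx0 alpha0] proj ball span]]]] := ih.
  by move=> d dcs; apply: Ccs; rewrite in_cons dcs orbT.
have [u su [w uw cE]] : exists2 u, lspan s u &
    exists2 w, orthogonal_complement dot (lspan s) w & c = x0 + u + w.
  have [u su uw] := proj (c - x0); exists u => //; exists (c - x0 - u) => //.
  by rewrite -(addrA x0) (addrCA u) subrr addr0 addrCA subrr addr0.
have [w0|w0] := eqVneq w 0.
  exists x0, s, alpha; split => // d; rewrite in_cons => /predU1P[->|/span//].
  by rewrite cE w0 addr0 [_ - x0]addrAC subrr add0r.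
have nw0 : 0 < `|w| by rewrite normr_gt0.
(* The first bound keeps the weight of [c] within [4^-1] of [2^-1], the second
   keeps the vector [h] below within [alpha]. *)
pose beta := Num.min (`|w| / 4) (alpha * `|w| / (4 * (`|w| + `|u|))).
have wu0 : 0 < 4 * (`|w| + `|u|) by have := normr_ge0 u; lra.
have beta0 : 0 < beta by rewrite lt_min !divr_gt0// mulr_gt0.
have beta1 : beta <= `|w| / 4 by rewrite ge_min lexx.
have beta2 : beta * (4 * (`|w| + `|u|)) <= alpha * `|w|.
  by rewrite -ler_pdivlMr// ge_min lexx orbT.
exists (x0 + 2^-1 *: (c - x0)), (w :: s), beta; split.
- split=> //; have := convex_comb 2^-1 C_convex Cc Cx0 ltac:(lra).
  congr C; apply: (dot_ext _ dot_norm) => z; rewrite !(dotE dot); lra.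
- move=> x; have [v sv vx] := proj x.
  exists (v + (dot x w / dot w w) *: w).
    by apply/lspan_cons; exists v => //; eexists.
  move=> _ /lspan_cons[f sf [a ->]].
  have ww0 : dot w w != 0.
    by rewrite -(sqr_norm _ dot_norm) sqrf_eq0 normr_eq0.
  have := vx _ sf; have := uw _ sf; have := uw _ sv.
  rewrite !(dotE dot) (dotC dot v w) => -> -> /eqP.
  by rewrite subr_eq0 => /eqP ->; field.
- move=> _ /lspan_cons[f sf [a ->]] fb.
  have [|fle wle] := ler_norm_orth _ dot_norm f (a *: w).
    by rewrite dotZr dotC (uw _ sf) mulr0.
  rewrite normrZ in wle.
  have aw : `|a| * `|w| <= beta by exact: le_trans fb.
  have a4 : `|a| <= 4^-1 by nra.
  have {}a4 : - 4^-1 <= a <= 4^-1 by rewrite -ler_norml.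
  (* The height [a] along [w] fixes the weight [l] of [c]; then [h] is what
     remains for the current span. *)
  pose l := 2^-1 + a; pose h := (1 - l)^-1 *: (f - a *: u).
  have l0 : 1 - l != 0 by apply/eqP; rewrite /l; lra.
  have -> : x0 + 2^-1 *: (c - x0) + (f + a *: w) = l *: c + (1 - l) *: (x0 + h).
    apply: (dot_ext _ dot_norm) => z.
    rewrite /h [(1 - l) *: _]scalerDr scalerA divff// cE /l !(dotE dot); lra.
  apply: convex_comb => //; last by rewrite /l; lra.
  apply: ball.
    by rewrite /h scalerBr scalerA -scaleNr; exact: lspan_lin.
  rewrite normrZ normfV (gtr0_norm (_ : 0 < 1 - l)); last by rewrite /l; lra.
  rewrite mulrC ler_pdivrMr; last by rewrite /l; lra.
  rewrite -(ler_pM2r nw0).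
  have : `|f - a *: u| <= `|f| + `|a| * `|u| by rewrite -normrZ ler_normB.
  have : 4^-1 <= 1 - l by rewrite /l; lra.
  move: `|f - _| => m l4 mle.
  have := ler_wpM2r (ltW nw0) mle; have := ler_wpM2r (ltW nw0) (le_trans fle fb).
  have := ler_wpM2r (normr_ge0 u) aw.
  have := ler_wpM2l (mulr_ge0 (ltW alpha0) (ltW nw0)) l4.
  lra.
- move=> d; rewrite in_cons => /predU1P[->|dcs].
    apply/lspan_cons; exists (2^-1 *: u + 0 *: u); first exact: lspan_lin.
    exists 2^-1; apply: (dot_ext _ dot_norm) => z; rewrite cE !(dotE dot); lra.
  apply/lspan_cons; exists (1 *: (d - x0) + - 2^-1 *: u).
    by apply: lspan_lin => //; exact: span.
  exists (- 2^-1); apply: (dot_ext _ dot_norm) => z; rewrite cE !(dotE dot); lra.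
Qed.
End RelativeInterior.

(** * Escaping perturbations *)

Section Perturbation.
Context {R : realType} {H : completeNormedModType R} (dot : {dot H for @idfun R}).
Hypothesis dot_norm : induces_norm dot.

Local Notation reject := (reject dot).

(** Relative to the origin [x0]: [f] read in the hyperplane orthogonal to [v],
    and the translation by [theta] along [v].  The two parts act on orthogonal
    summands, so the sum is nonexpansive together with [f]. *)
Definition slide (f : H -> H) (x0 v : H) (theta : R) (x : H) : H :=
  x0 + reject v (f (x0 + reject v (x - x0)) - x0) + (dot (x - x0) v + theta) *: v.

Lemma slide_nonexpansive f x0 v theta : dot v v = 1 ->
    (forall x y, `|f x - f y| <= `|x - y|) ->
  forall x y, `|slide f x0 v theta x - slide f x0 v theta y| <= `|x - y|.
Proof.
move=> v1 fne x y; rewrite (ler_norm_sqr _ dot_norm).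
pose x' := x0 + reject v (x - x0); pose y' := x0 + reject v (y - x0).
have -> : slide f x0 v theta x - slide f x0 v theta y =
    reject v (f x' - f y') + dot (x - y) v *: v.
  apply: (dot_ext _ dot_norm) => z.
  rewrite /slide -/x' -/y' /reject; move: (f x') (f y') => p q.
  rewrite !(dotE dot); lra.
rewrite pythagoras_reject//.
have : dot (x' - y') (x' - y') = dot (x - y) (x - y) - dot (x - y) v ^+ 2.
  have -> : x' - y' = reject v (x - y) + 0 *: v.
    by apply: (dot_ext _ dot_norm) => z; rewrite /x' /y' /reject !(dotE dot); ring.
  by rewrite pythagoras_reject// expr0n addr0.
have := fne x' y'; rewrite (ler_norm_sqr _ dot_norm).
have := sqr_ge0 (dot (f x' - f y') v); lra.
Qed.

(** The map is [slide f x0 v theta] followed by the nearest point retraction,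
    with [theta] half of [eps] and [y = x0 + a *: v].  The margin [sigma] makes
    the conclusion about [g y] hold for all nearby [w] at once. *)
Lemma escaping_perturbation (C : set H) (f : H -> H) (x0 : H) (F : set H)
    (xs : seq H) (eps r : R) :
    convex_set C -> closed C -> C x0 ->
    (forall x, C (f x)) -> (forall x y, `|f x - f y| <= `|x - y|) ->
    (forall M, exists p, [/\ orthogonal_complement dot F p, C (x0 + p) & M < `|p|]) ->
    {in xs, forall x, F (x - x0) /\ F (f x - x0)} -> 0 < eps -> 0 <= r ->
  exists g : H -> H, [/\ forall x, C (g x), forall x y, `|g x - g y| <= `|x - y|,
    {in xs, forall x, `|g x - f x| < eps} &
    exists y sigma, [/\ C y, 0 < sigma & forall w x, `|w - g y| < sigma ->
      `|x - x0| <= r -> `|y - x| < `|w - x|]].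
Proof.
move=> C_convex C_closed Cx0 Cf fne C_far xsF eps0 r0.
have [P [CP Pne Pmin]] := nonexpansive_retraction _ dot_norm _ C_convex C_closed
  (ex_intro _ x0 Cx0).
pose theta := eps / 2; have theta0 : 0 < theta by rewrite divr_gt0.
set D := `|f x0 - x0|; have D0 : 0 <= D by exact: normr_ge0.
(* The term [r ^+ 2 / theta] makes the part of [y - x] orthogonal to [v]
   contribute at most [theta / 2] to its norm; [D] keeps the weight [t]
   used for [gy] nonnegative. *)
pose a := r + r ^+ 2 / theta + D.
have rt0 : 0 <= r ^+ 2 / theta by rewrite divr_ge0// ?sqr_ge0// ltW.
have a0 : 0 <= a by rewrite /a; lra.
pose m := a + theta + D.
(* [L >= m] places [y] on the segment from [x0] to [x0 + p]; the other term
   makes the point [slide f x0 v theta y] almost belong to [C]. *)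
have [p [pF Cp pL]] := C_far (8 * (m * D / theta) + m).
have mD0 : 0 <= m * D / theta.
  by rewrite divr_ge0// ?(ltW theta0)// mulr_ge0// /m; lra.
pose L := `|p|; rewrite -/L in pL.
have mL : m <= L by lra.
have L0 : 0 < L by rewrite /m in mL; lra.
have mDL : m * D <= L * (theta / 8).
  have kL : 8 * (m * D / theta) <= L by rewrite /m; rewrite /m in pL; lra.
  have -> : m * D = m * D / theta * theta by rewrite divfK ?gt_eqF.
  have := ler_wpM2r (ltW theta0) kL; lra.
pose v := L^-1 *: p.
have pE : p = L *: v by rewrite scalerA divff ?scale1r// gt_eqF.
have v1 : dot v v = 1.
  by rewrite -(sqr_norm _ dot_norm) normrZ normfV normr_id mulVf ?expr1n// gt_eqF.
have vF x : F x -> dot x v = 0 by move=> Fx; rewrite dotZr dotC pF ?mulr0.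
rewrite pE in Cp; clearbody v.
pose g x := P (slide f x0 v theta x).
pose c := dot (f x0 - x0) v.
have cD : - D <= c <= D by rewrite -ler_norml; exact: dot_unit_le dot_norm _ _ v1.
pose y := x0 + a *: v.
have Cy : C y.
  have aL : 0 <= a / L <= 1.
    by rewrite divr_ge0// ?(ltW L0)//= ler_pdivrMr// mul1r; rewrite /m in mL; lra.
  have := convex_comb (a / L) C_convex Cp Cx0 aL.
  congr C; apply: (dot_ext _ dot_norm) => z; rewrite !(dotE dot).
  by field; rewrite gt_eqF.
have yslide : slide f x0 v theta y = f x0 + (a + theta - c) *: v.
  have y0 : x0 + reject v (y - x0) = x0.
    by apply: (dot_ext _ dot_norm) => z; rewrite /y /reject !(dotE dot) v1; ring.
  apply: (dot_ext _ dot_norm) => z.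
  rewrite /slide y0 /y /reject /c; move: (f x0) => fx0.
  by rewrite !(dotE dot) v1; ring.
(* With weight [t], the point of [C] on the segment from [f x0] to [x0 + L *: v]
   differs from this one only by [t *: (f x0 - x0)], and [t] is small. *)
have gy : `|slide f x0 v theta y - g y| <= theta / 8.
  pose t := (a + theta - c) / L.
  have t01 : 0 <= t <= 1.
    rewrite divr_ge0 ?(ltW L0)//=; first rewrite ler_pdivrMr// mul1r.
      by rewrite /m in mL; lra.
    by rewrite /a; lra.
  have Cq := convex_comb t C_convex Cp (Cf x0) t01.
  apply: le_trans (Pmin _ _ Cq) _; rewrite yslide.
  have -> : f x0 + (a + theta - c) *: v - (t *: (x0 + L *: v) + (1 - t) *: f x0) =
      t *: (f x0 - x0).
    apply: (dot_ext _ dot_norm) => z; move: (f x0) => fx0.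
    have tL : t * L = a + theta - c by rewrite divfK// gt_eqF.
    by rewrite -tL !(dotE dot); ring.
  rewrite normrZ ger0_norm; last by case/andP: t01.
  rewrite -/D -(ler_pM2l L0) mulrA [L * t]mulrC divfK ?gt_eqF//.
  apply: le_trans mDL; rewrite /m ler_wpM2r//; lra.
exists g; split.
- by move=> x; exact: CP.
- by move=> x z; apply: le_trans (Pne _ _) _; exact: slide_nonexpansive.
- move=> x /xsF[Fx Ffx].
  have -> : f x = P (f x).
    apply/eqP; rewrite -subr_eq0 -normr_le0; apply: le_trans (Pmin _ _ (Cf x)) _.
    by rewrite subrr normr0.
  apply: le_lt_trans (Pne _ _) _.
  have x'E : x0 + reject v (x - x0) = x.
    by rewrite /reject vF// scale0r subr0 addrC subrK.
  rewrite /slide x'E /reject !vF// scale0r subr0 add0r addrC (addrC x0) subrK.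
  rewrite addKr normrZ.
  have -> : `|v| = 1.
    by apply/eqP; rewrite -(@eqrXn2 _ 2)// (sqr_norm _ dot_norm) v1 expr1n.
  rewrite gtr0_norm// /theta; lra.
exists y, (theta / 8); split => //; first by rewrite divr_gt0.
move=> w x wy xr.
set z := slide f x0 v theta y in yslide gy.
pose b := dot (x - x0) v.
have bnorm : `|b| <= `|x - x0| by exact: dot_unit_le dot_norm _ _ v1.
have br : b <= r by apply: le_trans (ler_norm b) _; lra.
have ab : r ^+ 2 <= theta * (a - b).
  have : theta * (r ^+ 2 / theta) <= theta * (a - b).
    by rewrite ler_wpM2l ?(ltW theta0)// /a; lra.
  by rewrite mulrC divfK// gt_eqF.
(* Pythagoras for [y - x], whose component along [v] is [a - b]. *)
have yx : `|y - x| <= a - b + theta / 2.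
  have ab0 : 0 <= a - b by rewrite /a; lra.
  rewrite -(@ler_pXn2r _ 2)// ?nnegrE//; last lra.
  rewrite (sqr_norm _ dot_norm).
  have : `|x - x0| ^+ 2 <= r ^+ 2 by rewrite ler_pXn2r// nnegrE.
  rewrite (sqr_norm _ dot_norm) /y.
  have -> : dot (x0 + a *: v - x) (x0 + a *: v - x) =
      dot (x - x0) (x - x0) - 2 * a * b + a ^+ 2.
    by rewrite /b !(dotE dot) v1 (dotC dot v x) (dotC dot v x0) (dotC dot x0 x); ring.
  have := sqr_ge0 b; have := sqr_ge0 theta; nra.
(* From below, [w - x] is measured along [v] only. *)
have wx : dot (w - x) v <= `|w - x|.
  by apply: le_trans (ler_norm _) _; exact: dot_unit_le dot_norm _ _ v1.
have wz : `|dot (w - z) v| <= `|w - g y| + theta / 8.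
  apply: le_trans (dot_unit_le _ dot_norm _ _ v1) _.
  apply: le_trans (ler_distD (g y) _ _) _.
  by rewrite lerD2l distrC.
have : dot (w - x) v = dot (w - z) v + (a + theta - b).
  by rewrite yslide /b /c; move: (f x0) => fx0; rewrite !(dotE dot) v1; ring.
have : - dot (w - z) v <= `|dot (w - z) v| by rewrite -normrN ler_norm.
lra.
Qed.
End Perturbation.

(** * Maps with a fixed point in a ball are nowhere dense *)

Section Topology.
Context {R : realType} {H : normedModType R} (C : set H).
Local Notation N := (nonexpansive C).

(** The sets that have this property at each of their points form a topology, and
    it contains the subbasic balls. *)
Lemma nbhs_nonexpansive (W : set N) (f : N) : open W -> W f ->
  exists (xs : seq C) (e : R), 0 < e /\ forall g : N,
    {in xs, forall x, `|\val (\val g x) - \val (\val f x)| < e} -> W g.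
Proof.
pose op (W : set N) := forall f, W f -> exists (xs : seq C) (e : R), 0 < e /\
  forall g : N, {in xs, forall x, `|\val (\val g x) - \val (\val f x)| < e} -> W g.
suff : @open N `<=` op by move=> + oW; exact.
apply: open_nonexpansive_coarsest =>
  [f0 x e e0|f0 _|A B oA oB f0 [Af Bf]|D oD f0 [A DA Af]].
- move=> f1 f1f; exists [:: x], (e - `|\val (\val f1 x) - \val (\val f0 x)|).
  split; first by rewrite subr_gt0.
  move=> g /(_ x (mem_head _ _)); rewrite ltrBrDr; apply: le_lt_trans.
  exact: ler_distD.
- by exists [::], 1.
- have [xs [d [d0 xsd]]] := oA _ Af; have [ys [e [e0 yse]]] := oB _ Bf.
  exists (xs ++ ys), (Num.min d e); split; first by rewrite lt_min d0.
  move=> g gf; split; [apply: xsd|apply: yse] => x xin.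
    by have := gf x; rewrite mem_cat xin lt_min => /(_ isT)/andP[].
  by have := gf x; rewrite mem_cat xin orbT lt_min => /(_ isT)/andP[].
- by have [xs [e [e0 xse]]] := oD _ DA _ Af; exists xs, e; split=> // g /xse; exists A.
Qed.
End Topology.

Lemma nonexpansive_lift {R : realType} {H : normedModType R} (C : set H)
    (g : H -> H) :
    (forall x, C (g x)) -> (forall x y, `|g x - g y| <= `|x - y|) ->
  exists gN : nonexpansive C, forall x : C, \val (\val gN x) = g (\val x).
Proof.
move=> Cg gne; pose gC : {ptws C -> C} := fun x => SigSub (mem_set (Cg (\val x))).
have gCne : nonexpansive C gC by move=> x y; exact: gne.
by exists (SigSub (mem_set gCne)).
Qed.

Section Generic.
Context {R : realType} {H : completeNormedModType R} (dot : {dot H for @idfun R}).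
Hypothesis dot_norm : induces_norm dot.
Context (C : set H).
Hypotheses (C_convex : convex_set C) (C_closed : closed C).
Hypothesis C_unbounded : totally_unbounded dot C.

Definition fixes_point_in_ball (n : nat) : set (nonexpansive C) :=
  [set f | exists2 x : C, \val f x = x & `|\val x| <= n%:R].

Lemma totally_unbounded_far (x0 : H) (s : seq H) (alpha : R) :
    C x0 -> 0 < alpha ->
    (forall y, lspan s y -> `|y| <= alpha -> C (x0 + y)) ->
  forall M, exists p, [/\ orthogonal_complement dot (lspan s) p, C (x0 + p) & M < `|p|].
Proof.
move=> Cx0 alpha0 ball M; case: C_unbounded => nt nsb.
apply: contrapT => far; apply: nsb; split; first exact: nt.
exists x0, (lspan s), alpha; split=> //.
- by exists s.
- move=> _ [y [sy y1] <-]; exists (x0 + alpha *: y); last by rewrite addrC addKr.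
  apply: ball; first by rewrite -[_ *: _]addr0 -(scale0r y); exact: lspan_lin.
  by rewrite normrZ gtr0_norm// ler_piMr// ltW.
- exists M; split; first exact: num_real.
  move=> K MK x [xF [z Cz zx]]; rewrite /= leNgt; apply/negP => Kx.
  apply: far; exists x; split; [exact: xF| |exact: lt_trans Kx].
  by rewrite -zx addrC subrK.
Qed.

(** If [f] is interior to the closure, then [escaping_perturbation] gives a [g] in
    the closure that moves some [y] away from the ball; a map with a fixed point
    in the ball that is close to [g] at [y] fails to be nonexpansive. *)
Lemma fixes_point_in_ball_nowhere_dense n : nowhere_dense (fixes_point_in_ball n).
Proof.
apply/seteqP; split=> // f fcl.
have [xs [eps [eps0 near_f]]] := nbhs_nonexpansive _ _ _ (@open_interior _ _) fcl.
have [[c0 Cc0] _ _] := proj1 C_unbounded.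
have [P [CP Pne Pmin]] := nonexpansive_retraction _ dot_norm _ C_convex C_closed
  (ex_intro _ c0 Cc0).
(* [fP] extends [f] to the whole space, where [slide] needs it. *)
pose fP x := \val (\val f (SigSub (mem_set (CP x)) : C)).
have CfP x : C (fP x) by exact: set_mem (valP _).
have fPne x y : `|fP x - fP y| <= `|x - y|.
  by apply: le_trans (Pne x y); exact: (set_mem (valP f)).
have fPE (x : C) : fP (\val x) = \val (\val f x).
  congr (\val (\val f _)); apply/val_inj => /=; apply/eqP.
  rewrite eq_sym -subr_eq0 -normr_le0.
  by apply: le_trans (Pmin _ _ (set_mem (valP x))) _; rewrite subrr normr0.
pose ps : seq H := [seq \val x | x <- xs].
have [|x0 [s [alpha [[Cx0 alpha0] _ ball span]]]] :=
  finite_hull_interior _ dot_norm _ C_convex _ (ps ++ [seq fP p | p <- ps]) Cc0.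
  move=> c; rewrite mem_cat => /orP[] /mapP[p _ ->//].
  exact: set_mem (valP _).
have [|||g [Cg gne gf [y [sigma [Cy sigma0 gy]]]]] := escaping_perturbation _ dot_norm
  _ _ _ _ ps eps (n%:R + `|x0|) C_convex C_closed Cx0 CfP fPne
  (totally_unbounded_far _ _ _ Cx0 alpha0 ball).
- move=> p pps; split; apply: span; rewrite mem_cat ?pps// orbC.
  by apply/orP; left; exact: map_f.
- exact: eps0.
- by rewrite addr_ge0.
have [gN gNE] := nonexpansive_lift _ _ Cg gne.
have /interior_subset gNcl : interior (closure (fixes_point_in_ball n)) gN.
  apply: near_f => x xxs; rewrite gNE -fPE; apply: gf; exact: map_f.
pose yC : C := SigSub (mem_set Cy).
have gNb : nonexpansive_ball gN yC sigma gN.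
  by rewrite /nonexpansive_ball/= subrr normr0.
have [h [[x hx xn] hy]] :=
  gNcl _ (open_nbhs_nbhs (conj (nonexpansive_ball_open _ _ _) gNb)).
have hne : `|\val (\val h yC) - \val (\val h x)| <= `|y - \val x|.
  exact: (set_mem (valP h) yC x).
rewrite hx in hne.
rewrite /nonexpansive_ball/= gNE in hy.
have xr : `|\val x - x0| <= n%:R + `|x0|.
  by apply: le_trans (ler_normB _ _) _; rewrite lerD2r.
by have := lt_le_trans (gy _ _ hy xr) hne; rewrite ltxx.
Qed.
End Generic.

Theorem theorem4p1 (R : realType) (H : completeNormedModType R)
    (dot : {dot H for @idfun R}) (dot_norm : induces_norm dot)
    (H_separable : separable H) (H_infinite_dim : infinite_dim H)
    (C : set H) (C_closed : closed C) (C_convex : convex_set C)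
    (C_unbounded : totally_unbounded dot C) :
  exists2 Rs : set (nonexpansive C), residual Rs &
    forall f : nonexpansive C, Rs f -> ~ exists x : C, (\val f) x = x.
Proof.
exists (~` \bigcup_n fixes_point_in_ball C n).
  exists (fixes_point_in_ball C); last by rewrite setCK.
  exact: fixes_point_in_ball_nowhere_dense dot_norm _ C_convex C_closed C_unbounded.
move=> f nfix [x fx]; apply: nfix; exists (Num.truncn `|\val x|).+1 => //.
by exists x => //; apply/ltW; rewrite -truncn_le_nat.
Qed.
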